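(* Let $D_n=\langle a,b\mid a^n=b^2=1,\ bab=a^{-1}\rangle$, let $H\subseteq D_n$ be a connecting set, and let $\Gamma={\rm Cay}(D_n,H)$ with vertex set $V=V'\cup V''$ where $V'=\{a,a^2,\dots,a^n\}=\langle a\rangle$ and $V''=D_n\setminus V'$. For $1\le i\le n$ let $u_i$ be the number of walks of length $2$ in $\Gamma$ from $a$ to $a^i$ whose intermediate vertex lies in $V'$, and $w_i$ the number of walks of length $2$ from $a$ to $a^i$ whose intermediate vertex lies in $V''$. Put $$\Psi'_\Gamma(x)=u_1+u_2x+\dots+u_nx^{n-1},\qquad \Psi''_\Gamma(x)=w_1+w_2x+\dots+w_nx^{n-1}.$$ Then $\Gamma$ is singular if and only if the cyclotomic polynomial $\Phi_d(x)$ divides $\Psi'_\Gamma(x)-\Psi''_\Gamma(x)$ for some positive divisor $d$ of $n$.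
   Context: A subset $H$ of a finite group $G$ is a connecting set if $H^{-1}=H$, $1_G\notin H$, and $H$ generates $G$. The Cayley graph ${\rm Cay}(G,H)$ has vertex set $G$, with distinct $u,v$ adjacent iff $vu^{-1}\in H$. A graph is singular if its adjacency matrix is singular. $\Phi_d(x)$ is the $d$-th cyclotomic polynomial. *)

(* Defs.v *)
From HB Require Import structures.
From mathcomp Require Import all_boot all_order all_fingroup all_algebra.
From mathcomp Require Import all_solvable all_field.

Set Implicit Arguments.
Unset Strict Implicit.
Unset Printing Implicit Defensive.

Import GRing.Theory.

(* The type gT is the whole group D_n = < a, b | a^n = b^2 = 1, bab = a^-1 >.
   As [\isog Grp] says only that gT is isomorphic to the presented group, the
   other conjuncts say that a and b are generators satisfying the relations;
   by finiteness, the surjection from the presented group onto gT that they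
   induce is then an isomorphism. *)
Definition dihedral_presentation (gT : finGroupType) (n : nat) (a b : gT)
    : Prop :=
  [/\ <<[set a; b]>>%g = [set: gT],
      [/\ (a ^+ n = 1)%g, (b ^+ 2 = 1)%g & (b * a * b = a^-1)%g]
    & ([set: gT] \isog Grp (x : y : x ^+ n, y ^+ 2, y * x * y = x^-1))%g].

(* [H^-1] is the pointwise inverse of the set H. *)
Definition connecting_set (gT : finGroupType) (H : {set gT}) : Prop :=
  [/\ (H^-1 = H)%g, 1%g \notin H & <<H>>%g = [set: gT]].

Definition cayley (gT : finGroupType) (H : {set gT}) : rel gT :=
  fun u v => (u != v) && ((v * u^-1)%g \in H).

Definition adjacency (T : finType) (e : rel T) : 'M[rat]_#|T| :=
  \matrix_(i, j) ((e (enum_val i) (enum_val j))%:R)%R.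

Definition singular_graph (T : finType) (e : rel T) : Prop :=
  adjacency e \notin unitmx.

(* The walk x, p_0, p_1 of length 2 is encoded by the pair p of vertices
   that follow the initial vertex x; its intermediate vertex is p_0. *)
Definition walks2 (T : finType) (e : rel T) (W : {set T}) (x y : T)
    : {set 2.-tuple T} :=
  [set p : 2.-tuple T | [&& path e x p, last x p == y & tnth p ord0 \in W]].

(* The coefficient of X^i counts walks from a to a^(i+1). *)
Definition walk_poly (gT : finGroupType) (e : rel gT) (W : {set gT})
    (n : nat) (a : gT) : {poly int} :=
  (\poly_(i < n) Posz #|walks2 e W a (a ^+ i.+1)%g|)%R.

(* Main.v *)
(* Every n-th root of unity z defines a linear character chi of <a>, which we
   extend by zero to D_n and induce to a representation of D_n of degree 2.
   The span of chi and [x |-> chi (b x)] is stable under the adjacency operator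
   of Cay(D_n, H), which acts on it by a matrix with determinant c^2 - s t, for
     c = \sum_(h in H) chi h,         s = \sum_(h in H) chi (h b),
     t = \sum_(h in H) chi (b h).
   Sorting the walks from a by their intermediate vertex gives
   Psi'(z) = c^2 and Psi''(z) = s t.  As these functions for all z span the
   functions on D_n (Fourier inversion on <a>), the graph is singular iff
   Psi' - Psi'' vanishes at some n-th root of unity. *)
Require Import Defs.
From HB Require Import structures.
From mathcomp Require Import all_boot all_order all_fingroup all_algebra.
From mathcomp Require Import all_solvable all_field.
From mathcomp Require Import ring.

Set Implicit Arguments.
Unset Strict Implicit.
Unset Printing Implicit Defensive.

Import GRing.Theory.

(** * Order and coset structure of the dihedral group *)

Section DihedralGroup.

Local Open Scope group_scope.

(* 'D_m is the expected group only for m >= 4, so that n = 1 needs its own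
   model. *)
Lemma leq_card_dihedral_presentation (gT : finGroupType) n (a b : gT) :
  (0 < n)%N -> dihedral_presentation n a b -> (n.*2 <= #|gT|)%N.
Proof.
case: n => [//|[|n]] _ [_ _ isoG]; rewrite -cardsT.
  (* For n = 1, sending [x] to 1 and [y] to the generator respects the relations. *)
  have homZ2 : [set: 'Z_2] \homg [set: gT].
    rewrite isoG; apply/existsP; exists (1, Zp1) => /=.
    rewrite !xpair_eqE !expg1 eqxx; apply/and4P; split=> //.
    rewrite cycle1 joing1G; apply/eqP/setP=> x; rewrite !inE.
    apply/cycleP; exists (x : nat); rewrite Zp_expg; apply/val_inj.
    by case: x => -[|[|]].
  have := dvdn_leq (cardG_gt0 _) (card_homg homZ2).
  by rewrite [#|[set: 'Z_2]|]cardsT card_ord.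
have homD : 'D_(n.+2.*2) \homg [set: gT].
  have := isoGrp_hom (@Grp_dihedral n.+2 isT); rewrite isoG.
  case/existsP=> -[x y]; rewrite /= !xpair_eqE => /and4P[gen x1 y1 xy].
  apply/existsP; exists (x, y); rewrite /= !xpair_eqE gen x1 y1 /=.
  have yV : y^-1 = y by apply/eqP; rewrite eq_invg_mul; apply: y1.
  by rewrite -(eqP xy) conjgE yV mulgA.
by have := dvdn_leq (cardG_gt0 _) (card_homg homD); rewrite card_dihedral.
Qed.

(** Since [<[a]> * <[b]>] is everything, 2n <= [#|gT|] <= [#[a] * #[b]] <= 2n. Equality throughout
    forces [#[a] = n] and a trivial intersection, so [b] lies outside [<[a]>]. *)
Lemma dihedral_presentationP (gT : finGroupType) n (a b : gT) :
    (0 < n)%N -> dihedral_presentation n a b ->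
  [/\ #[a] = n, b * b = 1, b * a * b = a^-1
    & forall x, (b * x \in <[a]>) = (x \notin <[a]>)].
Proof.
move=> n_gt0 Dn; have leD := leq_card_dihedral_presentation n_gt0 Dn.
case: Dn => genG [an1 b2 bab] _.
have bb : b * b = 1 by rewrite -b2.
have invb : b^-1 = b by apply/eqP; rewrite eq_invg_mul bb.
have nAb : <[b]> \subset 'N(<[a]>).
  by rewrite norms_cycle conjgE invb mulgA bab groupV cycle_id.
have defG : <[a]> * <[b]> = [set: gT].
  rewrite -genG -norm_joinEr // joing_idl joing_idr; congr <<_>>.
have oa : (#[a] <= n)%N by rewrite dvdn_leq // order_dvdn an1.
have ob : (#[b] <= 2)%N by rewrite dvdn_leq // order_dvdn b2.
have := mul_cardG <[a]> <[b]>; rewrite defG cardsT => cardE.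
have I_gt0 := cardG_gt0 (<[a]> :&: <[b]>).
rewrite -!orderE in cardE.
have leM : (#[a] * #[b] <= n * 2)%N by rewrite leq_mul.
rewrite -muln2 in leD.
have leI : (#|gT| * #|<[a]> :&: <[b]>| <= #|gT|)%N.
  by rewrite -cardE (leq_trans leM).
have I1 : #|<[a]> :&: <[b]>| = 1%N.
  apply/eqP; rewrite eqn_leq I_gt0 andbT.
  by rewrite -(@leq_pmul2l #|gT|) ?muln1 // -cardsT cardG_gt0.
have n2E : (n * 2 = #[a] * #[b])%N.
  by apply/eqP; rewrite eqn_leq leM andbT cardE I1 muln1.
have oaE : #[a] = n.
  apply/eqP; rewrite eqn_leq oa -(@leq_pmul2r 2) // n2E.
  by rewrite leq_mul2l ob orbT.
have b'A : b \notin <[a]>.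
  apply/negP=> bA; have : b \in <[a]> :&: <[b]> by rewrite inE bA cycle_id.
  rewrite (card_le1_trivg (eq_leq I1)) inE => /eqP b1.
  by move/eqP: n2E; rewrite oaE b1 order1 eqn_pmul2l.
split=> // x; have [xA | x'A] := boolP (x \in <[a]>).
  by apply: contraNF b'A => bxA; rewrite -(mulgK x b) groupM ?groupV.
(* Inverting moves the factor [b] to the left of [x], where multiplication by [b] cancels it. *)
have : x^-1 \in <[a]> * <[b]> by rewrite defG inE.
case/mulsgP=> y w yA /cycleP[i ->]; rewrite -(odd_double_half i) -mul2n addnC.
rewrite expgD expgM b2 expg1n mul1g.
case: (odd i) => /(canRL invgK) xE; last by rewrite xE mulg1 groupV yA in x'A.
by rewrite xE invMg invb mulgA bb mul1g groupV.
Qed.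

End DihedralGroup.

(** * Walks of length 2 and the kernel of the adjacency matrix *)

Section Walks.

Local Open Scope ring_scope.

Lemma sum_cayley (gT : finGroupType) (R : pzSemiRingType) (H : {set gT}) :
    1%g \notin H -> forall (f : gT -> R) u,
  \sum_v (cayley H u v)%:R * f v = \sum_(h in H) f (h * u)%g.
Proof.
move=> H'1 f u; rewrite [RHS](reindex_inj (mulIg u^-1%g)) [RHS]big_mkcond /=.
apply: eq_bigr => v _; rewrite mulgKV /cayley.
have [<- | _] := eqVneq u v; first by rewrite mulgV (negPf H'1) mul0r.
by case: ifP; rewrite (mul1r, mul0r).
Qed.

Lemma cayley_sym (gT : finGroupType) (H : {set gT}) :
  (H^-1 = H)%g -> symmetric (cayley H).
Proof.
move=> invH u v; rewrite /cayley eq_sym; congr (_ && _).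
by rewrite -{1}invH mem_invg invMg invgK.
Qed.

Lemma card_walks2 (T : finType) (R : pzSemiRingType) (e : rel T) W x y :
  #|walks2 e W x y|%:R = \sum_(v in W) (e x v)%:R * (e v y)%:R :> R.
Proof.
have -> : walks2 e W x y =
    [set [tuple v; y] | v in [set v in W | e x v && e v y]].
  apply/setP=> p; rewrite inE; apply/and3P/imsetP => [[pth lst pW] | [v]].
    case/tupleP: p pth lst pW => v p; case/tupleP: p => w p.
    rewrite tuple0 /= andbT => /andP[xv vw] /eqP wy vW.
    exists v; first by rewrite inE vW xv -wy.
    by apply/val_inj; rewrite /= wy.
  by rewrite inE => /and3P[vW xv vy] -> /=; rewrite xv vy eqxx.
rewrite card_imset => [|v w [->] //].
rewrite -sum1_card natr_sum big_mkcond [RHS]big_mkcond /=.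
apply: eq_bigr => v _; rewrite inE; case: (v \in W) => //=.
by case: (e x v); case: (e v y); rewrite /= ?(mulr0, mul0r, mulr1).
Qed.

(** Invertibility is unaffected by field extension, so kernel vectors may be sought over [algC],
    which contains the roots of unity. *)
Lemma singular_graphP (T : finType) (e : rel T) :
  singular_graph e <->
  exists2 f : T -> algC, exists x, f x != 0 &
    forall v, \sum_u f u * (e u v)%:R = 0.
Proof.
rewrite /singular_graph -(map_unitmx (ratr : rat -> algC)) unitmxE unitfE negbK.
split=> [/det0P[f nz_f fA] | [f [x nz_fx] fA]].
  have [i nz_fi] : exists i, f 0 i != 0 by apply/rV0Pn.
  exists (fun x => f 0 (enum_rank x)).
    by exists (enum_val i); rewrite enum_valK.
  move=> v; have /rowP/(_ (enum_rank v)) := fA; rewrite !mxE => fAv.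
  rewrite -[RHS]fAv [RHS](reindex _ (onW_bij _ (@enum_rank_bij T))).
  by apply: eq_bigr => u _; rewrite !mxE !enum_rankK rmorph_nat.
apply/det0P; exists (\row_i f (enum_val i)).
  by apply/rV0Pn; exists (enum_rank x); rewrite mxE enum_rankK.
apply/rowP=> j; rewrite !mxE -[RHS](fA (enum_val j)).
rewrite [RHS](reindex _ (onW_bij _ (@enum_val_bij T))).
by apply: eq_bigr => i _; rewrite !mxE rmorph_nat.
Qed.

End Walks.

(** * The induced character and its two-dimensional invariant space *)

Section InducedCharacter.

Variables (gT : finGroupType) (F : fieldType) (a b : gT) (z : F).

Local Open Scope ring_scope.

(** At most one exponent below [#[a]] contributes, so this is [a ^+ i] |-> [z ^+ i] extended by
    zero, with no discrete logarithm to choose. *)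
Definition cycle_char (x : gT) : F :=
  \sum_(i < #[a]%g | (a ^+ i)%g == x) z ^+ i.

Local Notation chi := cycle_char.

Lemma sum_cycle_char (f : gT -> F) :
  \sum_x f x * chi x = \sum_(i < #[a]%g) f (a ^+ i)%g * z ^+ i.
Proof.
rewrite [RHS](partition_big (fun i : 'I_ _ => (a ^+ i)%g) predT) //=.
by apply: eq_bigr => x _; rewrite mulr_sumr; apply: eq_bigr => i /eqP->.
Qed.

Lemma cycle_char_out x : x \notin <[a]>%g -> chi x = 0.
Proof.
move=> x'A; apply: big1 => i /eqP xE.
by rewrite -xE mem_cycle in x'A.
Qed.

Hypothesis z_unity : z ^+ #[a]%g = 1.

Lemma cycle_charX m : chi (a ^+ m)%g = z ^+ m.
Proof.
rewrite /chi -expg_mod_order -(expr_mod m z_unity).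
have lt_m : (m %% #[a]%g < #[a]%g)%N by rewrite ltn_pmod ?order_gt0.
rewrite (big_pred1 (Ordinal lt_m)) // => i.
by rewrite eq_expg_mod_order modn_mod (modn_small (ltn_ord i)).
Qed.

(** If exactly one factor is in [<[a]>], both sides vanish. Two factors outside are excluded, as
    their product may fall inside. *)
Lemma cycle_charM x y :
  (x \in <[a]>%g) || (y \in <[a]>%g) -> chi (x * y)%g = chi x * chi y.
Proof.
have [xA _ | x'A /= yA] := boolP (x \in <[a]>%g); last first.
  by rewrite (cycle_char_out x'A) mul0r cycle_char_out // groupMr.
have [/cycleP[j ->] | y'A] := boolP (y \in <[a]>%g); last first.
  by rewrite (cycle_char_out y'A) mulr0 cycle_char_out // groupMl.
by case/cycleP: xA => i ->; rewrite -expgD !cycle_charX exprD.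
Qed.

Hypotheses (bb : (b * b = 1)%g) (bab : (b * a * b = a^-1)%g).
Hypothesis mem_mulb : forall x, ((b * x)%g \in <[a]>%g) = (x \notin <[a]>%g).

Lemma cycle_conj_involution x : x \in <[a]>%g -> (b * x * b = x^-1)%g.
Proof.
have invb : b^-1%g = b by apply/eqP; rewrite eq_invg_mul bb.
case/cycleP=> i ->; rewrite -{1}invb -mulgA -conjgE conjXg conjgE invb mulgA.
by rewrite bab expgVn.
Qed.

Lemma mem_cycle_mulb x : ((x * b)%g \in <[a]>%g) = (x \notin <[a]>%g).
Proof.
have [xA | x'A] := boolP (x \in <[a]>%g).
  by rewrite groupMl // -[LHS]negbK -mem_mulb bb group1.
rewrite -[x]mul1g -bb -(mulgA b b x) cycle_conj_involution ?mem_mulb //.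
by rewrite groupV mem_mulb.
Qed.

(* The first entry of the multiplicativity of the induced representation
   [x |-> ((chi x, chi (x b)), (chi (b x), chi (b x b)))]. *)
Lemma cycle_charM_induced x y :
  chi (x * y)%g = chi x * chi y + chi (x * b)%g * chi (b * y)%g.
Proof.
have [xA | x'A] := boolP (x \in <[a]>%g).
  rewrite (cycle_charM (y := y)) ?xA // (cycle_char_out (x := (x * b)%g)).
    by rewrite mul0r addr0.
  by rewrite mem_cycle_mulb xA.
rewrite (cycle_char_out x'A) mul0r add0r -cycle_charM ?mem_cycle_mulb ?x'A //.
by rewrite mulgA -(mulgA x) bb mulg1.
Qed.

Lemma cycle_char_conj x : chi (b * x * b)%g = chi x^-1%g.
Proof.
have [xA | x'A] := boolP (x \in <[a]>%g).
  by rewrite cycle_conj_involution.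
by rewrite !cycle_char_out ?groupV // mem_cycle_mulb mem_mulb x'A.
Qed.

Variable H : {set gT}.

Let c := \sum_(h in H) chi h.
Let s := \sum_(h in H) chi (h * b)%g.
Let t := \sum_(h in H) chi (b * h)%g.

Hypotheses (H'1 : 1%g \notin H) (invH : (H^-1 = H)%g).

(** The symmetry of [H] makes the two diagonal entries of the 2 x 2 matrix equal. *)
Lemma sum_cycle_char_conj : \sum_(h in H) chi (b * h * b)%g = c.
Proof.
rewrite /c (reindex_inj invg_inj); apply: eq_big => h.
  by rewrite -mem_invg invH.
by rewrite cycle_char_conj invgK.
Qed.

Lemma sum_cayley_cycle_char u :
  \sum_v (cayley H u v)%:R * chi v = c * chi u + s * chi (b * u)%g.
Proof.
rewrite sum_cayley // !mulr_suml -big_split; apply: eq_bigr => h _.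
exact: cycle_charM_induced.
Qed.

Lemma sum_cayley_cycle_char_mulb u :
  \sum_v (cayley H u v)%:R * chi (b * v)%g = t * chi u + c * chi (b * u)%g.
Proof.
rewrite (sum_cayley H'1 (fun v => chi (b * v)%g)) -{1}sum_cycle_char_conj.
rewrite !mulr_suml -big_split; apply: eq_bigr => h _.
by rewrite mulgA; apply: cycle_charM_induced.
Qed.

(** A walk a, h a, k h a ends at [a ^+ i.+1] exactly when k h = [a ^+ i], so it is weighted by
    [z ^+ i] = chi (k h). *)
Lemma horner_walk_poly (W : {set gT}) :
  (map_poly intr (walk_poly (cayley H) W #[a]%g a)).[z] =
    \sum_(h in H) ((h * a)%g \in W)%:R * \sum_(k in H) chi (k * h)%g.
Proof.
rewrite (horner_coef_wide _ (leq_trans (size_poly _ _) (size_poly _ _))).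
transitivity (\sum_(i < #[a]%g) \sum_(v in W) (cayley H a v)%:R *
    ((cayley H v (a ^+ i.+1)%g)%:R * z ^+ i)).
  apply: eq_bigr => i _; rewrite coef_map coef_poly ltn_ord /=.
  rewrite -pmulrn card_walks2 mulr_suml.
  by apply: eq_bigr => v _; rewrite mulrA.
pose g v := (v \in W)%:R * \sum_(k in H) chi (k * (v * a^-1))%g.
transitivity (\sum_(h in H) g (h * a)%g); last first.
  by apply: eq_bigr => h _; rewrite /g mulgK.
rewrite exchange_big -sum_cayley // big_mkcond; apply: eq_bigr => v _.
rewrite /g; case: (v \in W); last by rewrite mul0r mulr0.
rewrite mul1r -mulr_sumr; congr (_ * _).
under [RHS]eq_bigr do rewrite mulgA.
rewrite -(sum_cayley H'1 (fun y => chi (y * a^-1)%g)).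
rewrite (reindex_inj (mulIg a)) /=.
under [RHS]eq_bigr do rewrite mulgK.
rewrite (sum_cycle_char (fun x => (cayley H v (x * a)%g)%:R)).
by apply: eq_bigr => i _; rewrite expgSr.
Qed.

Lemma horner_walk_poly_cycle :
  (map_poly intr (walk_poly (cayley H) <[a]>%g #[a]%g a)).[z] = c * c.
Proof.
rewrite horner_walk_poly {2}/c mulr_sumr; apply: eq_bigr => h _.
rewrite groupMr ?cycle_id //; have [hA | h'A] := boolP (h \in <[a]>%g).
  rewrite mul1r mulr_suml; apply: eq_bigr => k _.
  by rewrite cycle_charM // hA orbT.
by rewrite mul0r (cycle_char_out h'A) mulr0.
Qed.

Lemma horner_walk_poly_cycleC :
  (map_poly intr (walk_poly (cayley H) ([set: gT] :\: <[a]>%g) #[a]%g a)).[z]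
    = s * t.
Proof.
rewrite horner_walk_poly /t mulr_sumr; apply: eq_bigr => h _.
rewrite !inE andbT groupMr ?cycle_id //.
have [hA | h'A] := boolP (h \in <[a]>%g); last first.
  rewrite mul1r mulr_suml; apply: eq_bigr => k _.
  (* As chi h = 0, only the product chi (k b) chi (b h) survives. *)
  by rewrite (cycle_charM_induced k) (cycle_char_out h'A) mulr0 add0r.
by rewrite mul0r (@cycle_char_out (b * h)%g) ?mulr0 // mem_mulb hA.
Qed.

(** Pairing [f] with the two spanning functions gives a homogeneous 2 x 2 system with determinant
    [c * c - s * t], solved by Cramer's rule. *)
Lemma cayley_left_kernel (f : gT -> F) :
    (forall v, \sum_u f u * (cayley H u v)%:R = 0) -> c * c - s * t != 0 ->
  \sum_u f u * chi u = 0 /\ \sum_u f u * chi (b * u)%g = 0.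
Proof.
move=> fA nz_det.
pose X := \sum_u f u * chi u.
pose Y := \sum_u f u * chi (b * u)%g.
have fA0 g : \sum_u f u * (\sum_v (cayley H u v)%:R * g v) = 0.
  under eq_bigr do rewrite mulr_sumr.
  rewrite exchange_big big1 //= => v _.
  under eq_bigr do rewrite mulrA.
  by rewrite -mulr_suml fA mul0r.
have cX : c * X + s * Y = 0.
  rewrite -[RHS](fA0 chi) !mulr_sumr -big_split; apply: eq_bigr => u _ /=.
  by rewrite sum_cayley_cycle_char; ring.
have cY : t * X + c * Y = 0.
  rewrite -[RHS](fA0 (fun v => chi (b * v)%g)) !mulr_sumr -big_split.
  by apply: eq_bigr => u _ /=; rewrite sum_cayley_cycle_char_mulb; ring.
split; apply: (mulfI nz_det); rewrite mulr0.
  transitivity (c * (c * X + s * Y) - s * (t * X + c * Y)).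
    by rewrite -/X; ring.
  by rewrite cX cY !mulr0 subr0.
transitivity (c * (t * X + c * Y) - t * (c * X + s * Y)).
  by rewrite -/Y; ring.
by rewrite cX cY !mulr0 subr0.
Qed.

Lemma cayley_kernel_of_det0 :
    c * c - s * t = 0 ->
  exists2 f : gT -> F, exists x, f x != 0 &
    forall u, \sum_v (cayley H u v)%:R * f v = 0.
Proof.
move=> det0; pose f p q v : F := p * chi v + q * chi (b * v)%g.
have sum_f p q u : \sum_v (cayley H u v)%:R * f p q v =
    (p * c + q * t) * chi u + (p * s + q * c) * chi (b * u)%g.
  transitivity (p * (c * chi u + s * chi (b * u)%g) +
                q * (t * chi u + c * chi (b * u)%g)); last by ring.
  rewrite -sum_cayley_cycle_char -sum_cayley_cycle_char_mulb.
  by rewrite !mulr_sumr -big_split; apply: eq_bigr => v _; rewrite /f /=; ring.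
have chi1 : chi 1%g = 1 by rewrite -[1%g]/(a ^+ 0)%g cycle_charX.
have chib : chi b = 0 by rewrite cycle_char_out // -mem_mulb bb group1.
have f1 p q : f p q 1%g = p by rewrite /f mulg1 chi1 chib; ring.
have fb p q : f p q b = q by rewrite /f bb chi1 chib; ring.
(* The coefficients (p, q) must kill the matrix with rows (c, s) and (t, c) from the left: (t, -c)
   does if [t] is nonzero; otherwise [c] is zero too and (0, 1) does. *)
have [t0 | nz_t] := eqVneq t 0; last first.
  exists (f t (- c)); first by exists 1%g; rewrite f1.
  move=> u; rewrite sum_f.
  transitivity (- (c * c - s * t) * chi (b * u)%g); first by ring.
  by rewrite det0 oppr0 mul0r.
have c0 : c = 0.
  by move: det0; rewrite t0 mulr0 subr0 => /eqP; rewrite mulf_eq0 orbb => /eqP.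
exists (f 0 1); first by exists b; rewrite fb oner_eq0.
by move=> u; rewrite sum_f t0 c0; ring.
Qed.

End InducedCharacter.

(** * Cyclotomic divisibility and vanishing at roots of unity *)

Section CyclotomicRoots.

Local Open Scope ring_scope.

(** ['Phi_d] is the minimal polynomial of [z] over the rationals. *)
Lemma Cyclotomic_dvdp d (z : algC) (p : {poly int}) :
  d.-primitive_root z -> ('Phi_d %| p) = root (map_poly intr p) z.
Proof.
move=> prim_z; have [q [Dq _] dv_q] := minCpolyP z.
have ZtoQtoC (r : {poly int}) :
    map_poly (ratr : rat -> algC) (map_poly intr r) = map_poly intr r.
  by rewrite -map_poly_comp; apply: eq_map_poly => i /=; rewrite ratr_int.
have -> : map_poly intr p = map_poly (ratr : rat -> algC) (map_poly intr p).
  by rewrite ZtoQtoC.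
rewrite dv_q -dvdp_rat_int; congr (_ %| _).
apply: (map_poly_inj (ratr : rat -> algC)).
by rewrite ZtoQtoC (Cintr_Cyclotomic prim_z) -(minCpoly_cyclotomic prim_z).
Qed.

(** A polynomial of degree below n with n distinct roots is zero; this replaces the Fourier
    inversion formula. *)
Lemma sum_unity_roots_eq0 n (g : nat -> algC) :
    (forall z, z ^+ n = 1 -> \sum_(i < n) g i * z ^+ i = 0) ->
  forall i, (i < n)%N -> g i = 0.
Proof.
move=> g0 i lt_i.
have [w prim_w] := C_prim_root_exists (leq_ltn_trans (leq0n i) lt_i).
pose p := \poly_(i < n) g i.
suff p0 : p = 0 by have := coef_poly n g i; rewrite -/p p0 coef0 lt_i.
pose rs := [seq w ^+ j | j <- iota 0 n].
apply: (@roots_geq_poly_eq0 _ _ rs).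
- apply/allP=> _ /mapP[j _ ->]; apply/rootP; rewrite horner_poly g0 //.
  by rewrite exprAC (prim_expr_order prim_w) expr1n.
- rewrite map_inj_in_uniq ?iota_uniq // => j k.
  rewrite !mem_iota /= => lt_j lt_k.
  by move/eqP; rewrite (eq_prim_root_expr prim_w) !modn_small // => /eqP.
by rewrite size_map size_iota size_poly.
Qed.

End CyclotomicRoots.

(** * Singularity as vanishing at an n-th root of unity *)

Lemma singular_cayley_dihedralP (gT : finGroupType) n (a b : gT)
    (H : {set gT}) :
    (0 < n)%N -> dihedral_presentation n a b -> connecting_set H ->
  let Psi W := walk_poly (cayley H) W n a in
  let P := (Psi <[a]>%g - Psi ([set: gT] :\: <[a]>%g))%R in
  singular_graph (cayley H) <->
  exists2 z : algC, (z ^+ n = 1)%R & root (map_poly intr P) z.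
Proof.
move=> n_gt0 /(dihedral_presentationP n_gt0)[<- bb bab mem_mulb].
move=> [invH H'1 _] Psi P.
pose chi (z : algC) x := cycle_char a z x.
pose det (z : algC) := ((\sum_(h in H) chi z h) * (\sum_(h in H) chi z h) -
  (\sum_(h in H) chi z (h * b)%g) * (\sum_(h in H) chi z (b * h)%g))%R.
have rootP z : (z ^+ #[a]%g = 1)%R -> root (map_poly intr P) z = (det z == 0%R).
  move=> z1; rewrite rootE rmorphB hornerD hornerN.
  by rewrite horner_walk_poly_cycle ?(@horner_walk_poly_cycleC _ _ a b).
split=> [/singular_graphP[f [x nz_fx] fA] | [z z1]]; last first.
  rewrite rootP // => /eqP det0; apply/singular_graphP.
  have [f nz_f fA] := cayley_kernel_of_det0 z1 bb bab mem_mulb H'1 invH det0.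
  exists f => // v; rewrite -[RHS](fA v).
  (* Symmetry of the graph turns a right kernel vector into a left one. *)
  by apply: eq_bigr => u _; rewrite mulrC cayley_sym.
(* All n-th roots of unity are powers of [w], so whether [det] vanishes at one of them is a finite,
   decidable question. *)
have [w prim_w] := C_prim_root_exists (order_gt0 a).
have [/existsP[i /eqP deti] | det'0] :=
  boolP [exists i : 'I_#[a]%g, det (w ^+ i)%R == 0%R].
  have wi1 : ((w ^+ i) ^+ #[a]%g = 1)%R.
    by rewrite exprAC (prim_expr_order prim_w) expr1n.
  by exists (w ^+ i)%R; rewrite ?rootP ?deti.
have ker_f z : (z ^+ #[a]%g = 1)%R -> (\sum_u f u * chi z u = 0)%R /\
    (\sum_u f u * chi z (b * u)%g = 0)%R.
  move=> z1.
  apply: (@cayley_left_kernel _ _ a b z z1 bb bab mem_mulb H H'1 invH) => //.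
  have [i ->] := prim_rootP prim_w z1.
  by apply: contra det'0 => deti; apply/existsP; exists i.
have fA0 i : f (a ^+ i)%g = 0%R.
  rewrite -expg_mod_order.
  apply: (@sum_unity_roots_eq0 #[a]%g (fun i => f (a ^+ i)%g)).
    by move=> z /ker_f[f0 _]; rewrite -sum_cycle_char.
  by rewrite ltn_mod order_gt0.
have fbA0 i : f (b * a ^+ i)%g = 0%R.
  rewrite -expg_mod_order.
  apply: (@sum_unity_roots_eq0 #[a]%g (fun i => f (b * a ^+ i)%g)).
    move=> z /ker_f[_ f0].
    rewrite -(sum_cycle_char a z (fun x => f (b * x)%g)) -[RHS]f0.
    (* Translating by [b] carries the coset of [b] onto [<[a]>], where chi is supported. *)
    rewrite [RHS](reindex_inj (mulgI b)).
    by apply: eq_bigr => u _; rewrite mulgA bb mul1g.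
  by rewrite ltn_mod order_gt0.
case/negP: nz_fx.
have [/cycleP[i ->] | x'A] := boolP (x \in <[a]>%g); first by rewrite fA0.
have /cycleP[i bxE] : (b * x)%g \in <[a]>%g by rewrite mem_mulb.
by rewrite -[x]mul1g -bb -mulgA bxE fbA0.
Qed.

(* In the conclusion, [%|] is pseudo-divisibility in {poly int}; since 'Phi_d
   is monic, it is ordinary divisibility (over the integers, or equivalently
   over the rationals). *)
Theorem theorem1p4 (gT : finGroupType) (n : nat) (a b : gT) (H : {set gT})
    (n_gt0 : (0 < n)%N)
    (dihedral_gT : dihedral_presentation n a b)
    (connecting_H : connecting_set H) :
  let Gamma := cayley H in
  let V' : {set gT} := <[a]>%g in
  let V'' := [set: gT] :\: V' in
  let Psi' := walk_poly Gamma V' n a in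
  let Psi'' := walk_poly Gamma V'' n a in
  singular_graph Gamma <->
  (exists d : nat, [/\ (0 < d)%N, (d %| n)%N & ('Phi_d %| Psi' - Psi'')%R]).
Proof.
move=> Gamma V' V'' Psi' Psi''.
have singularP := singular_cayley_dihedralP n_gt0 dihedral_gT connecting_H.
split=> [/singularP[z z1 Pz] | [d [d_gt0 dv_d dv_P]]].
  (* The divisor d is the exact order of the root [z]. *)
  have [d prim_z dv_d] := prim_order_exists n_gt0 z1.
  exists d; split=> //; first exact: prim_order_gt0 prim_z.
  by rewrite (Cyclotomic_dvdp _ prim_z).
have [z prim_z] := C_prim_root_exists d_gt0.
apply/singularP; exists z; last by rewrite -(Cyclotomic_dvdp _ prim_z).
by apply/eqP; rewrite -(prim_order_dvd prim_z).
Qed.
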